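(* Let $(A,\prec,\succ)$ be a dendriform algebra over a field $k$ of characteristic zero, let $a\in A$, and let $X,Y\in\overline A[[\lambda]]$ be the solutions of $$X=\mathbf 1+\lambda a\prec X,\qquad Y=\mathbf 1-Y\succ\lambda a .$$ Let $\Omega':=\Omega'(\lambda a)$ be the element of $\lambda\overline A[[\lambda]]$ such that $X=\exp^*(\Omega')$ and $Y=\exp^*(-\Omega')$ (there is a unique such element). Then $\Omega'$ obeys the recursive equation $$\Omega'(\lambda a)=\frac{R_\lhd[\Omega']}{1-\exp(-R_\lhd[\Omega'])}(\lambda a)=\sum_{m\ge 0}(-1)^m\frac{B_m}{m!}R_\lhd[\Omega']^m(\lambda a),$$ or alternatively $$\Omega'(\lambda a)=\frac{L_\rhd[\Omega']}{\exp(L_\rhd[\Omega'])-1}(\lambda a)=\sum_{m\ge 0}\frac{B_m}{m!}L_\rhd[\Omega']^m(\lambda a),$$ where the $B_m$ are the Bernoulli numbers.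
   Context: A dendriform algebra over $k$ is a $k$-vector space $A$ with two bilinear operations $\prec,\succ$ such that, with $a*b:=a\prec b+a\succ b$, for all $a,b,c\in A$: $(a\prec b)\prec c=a\prec(b*c)$, $(a\succ b)\prec c=a\succ(b\prec c)$, $a\succ(b\succ c)=(a*b)\succ c$. The product $*$ is then associative. Augmentation: $\overline A:=A\oplus k\mathbf 1$, with $a\prec\mathbf 1:=a=:\mathbf 1\succ a$ and $\mathbf 1\prec a:=0=:a\succ\mathbf 1$ for $a\in A$, and $\mathbf 1*\mathbf 1=\mathbf 1$, so $\mathbf 1$ is a unit for $*$ ($\mathbf 1\prec\mathbf 1$ and $\mathbf 1\succ\mathbf 1$ are not defined). All operations are extended $\lambda$-bilinearly (and $\lambda$-adically continuously) to formal power series in $\lambda$. The solutions of the two equations are $X=\sum_{n\ge0}\lambda^n w_\prec^{(n)}(a)$ and $Y=\sum_{n\ge0}(-\lambda)^n w_\succ^{(n)}(a)$, where $w_\prec^{(0)}(a)=w_\succ^{(0)}(a)=\mathbf 1$, $w_\prec^{(n)}(a)=a\prec w_\prec^{(n-1)}(a)$, $w_\succ^{(n)}(a)=w_\succ^{(n-1)}(a)\succ a$. Pre-Lie products on $A$: $a\rhd b:=a\succ b-b\prec a$ and $a\lhd b:=a\prec b-b\succ a$. Operators: $L_\rhd[a](b):=a\rhd b$, $R_\lhd[a](b):=b\lhd a$. Exponential: $\exp^*(x):=\sum_{n\ge0}x^{*n}/n!$ for $x\in\lambda\overline A[[\lambda]]$, with $x^{*0}=\mathbf 1$. (An element $\Omega'$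 as in the claim has no component along $\mathbf 1$, i.e. lies in $\lambda A[[\lambda]]$, so the operators are well defined on $A[[\lambda]]$.) Bernoulli numbers: $\frac{z}{e^z-1}=\sum_{m\ge0}\frac{B_m}{m!}z^m$. *)

(* Defs.v *)
From HB Require Import structures.
From mathcomp Require Import all_boot all_order all_algebra.

Set Implicit Arguments.
Unset Strict Implicit.
Unset Printing Implicit Defensive.

Import GRing.Theory.
Local Open Scope ring_scope.

Reserved Notation "x ≺ y" (at level 40, no associativity).
Reserved Notation "x ≻ y" (at level 40, no associativity).

HB.mixin Record Lmodule_isDendriform (k : fieldType) A of GRing.Lmodule k A := {
  dprec : A -> A -> A;
  dsucc : A -> A -> A;
  dprec_linearl : forall b, linear (dprec^~ b);
  dprec_linearr : forall a, linear (dprec a);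
  dsucc_linearl : forall b, linear (dsucc^~ b);
  dsucc_linearr : forall a, linear (dsucc a);
  dprecA : forall a b c,
    dprec (dprec a b) c = dprec a (dprec b c + dsucc b c);
  dsucc_precA : forall a b c,
    dprec (dsucc a b) c = dsucc a (dprec b c);
  dsuccA : forall a b c,
    dsucc a (dsucc b c) = dsucc (dprec a b + dsucc a b) c
}.

#[short(type="dendriformType")]
HB.structure Definition Dendriform (k : fieldType) :=
  { A of GRing.Lmodule k A & Lmodule_isDendriform k A }.

Notation "x ≺ y" := (dprec x y) : ring_scope.
Notation "x ≻ y" := (dsucc x y) : ring_scope.

Section Augmentation.
Variables (k : fieldType) (A : dendriformType k).
Implicit Types (a b : A).

Definition rhd a b : A := a ≻ b - b ≺ a.
Definition lhd a b : A := a ≺ b - b ≻ a.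

(** The pair [(b, t)] stands for [b + t 1]. *)
Definition aug : lmodType k := (A * k^o)%type.

Definition aug1 : aug := (0, 1).
Definition aug_in a : aug := (a, 0).

(** [1 ≺ 1] and [1 ≻ 1] are undefined; the bilinear extensions below give them
    the junk value [0], and [astar] adds the separate convention [1 * 1 = 1]. *)
Definition aprec (x y : aug) : aug := (x.1 ≺ y.1 + y.2 *: x.1, 0).
Definition asucc (x y : aug) : aug := (x.1 ≻ y.1 + x.2 *: y.1, 0).
Definition astar (x y : aug) : aug :=
  aprec x y + asucc x y + (x.2 * y.2) *: aug1.

End Augmentation.

Arguments aug {k} A.
Arguments aug1 {k A}.

(** [f n] is the coefficient of degree [n]. *)
Definition series (V : Type) := nat -> V.

Definition monom (V : nmodType) (d : nat) (v : V) : series V :=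
  fun n => if n == d then v else 0.

(** Extension of a bilinear operation to power series. *)
Definition conv (U V : Type) (W : nmodType) (op : U -> V -> W)
    (f : series U) (g : series V) : series W :=
  fun n => \sum_(i < n.+1) op (f i) (g (n - i)%N).

(** [s] is the sum of the family [u] for the adic topology: modulo degree [d],
    the partial sums are eventually equal to [s]. *)
Definition is_sum (V : nmodType) (u : nat -> series V) (s : series V) : Prop :=
  forall d, exists N, forall M, (N <= M)%N ->
    forall n, (n < d)%N -> \sum_(m < M) u m n = s n.

(** [s] is [f(T)(v)] for the scalar power series [f = \sum_m f m z^m]. *)
Definition is_opseries (k : fieldType) (V : lmodType k) (f : series k)
    (T : series V -> series V) (v s : series V) : Prop :=
  is_sum (fun m n => f m *: iter m T v n) s.

Section Scalars.
Variable k : fieldType.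
Implicit Types f g : series k.

Definition expz (c : k) : series k := fun n => c ^+ n / n`!%:R.
Definition expm1 : series k := fun n => expz 1 n - monom 0 1 n.
Definition onemexpN : series k := fun n => monom 0 1 n - expz (-1) n.

Fixpoint sinv_seq f (n : nat) : seq k :=
  if n is n'.+1 then
    let s := sinv_seq f n' in
    rcons s (- (f 0%N)^-1 * \sum_(i < n) f (n - i)%N * s`_i)
  else [:: (f 0%N)^-1].

(** The multiplicative inverse of [f], when [f 0 != 0]. *)
Definition sinv f : series k := fun n => (sinv_seq f n)`_n.

(** [z / g] for [g] of order one, computed as the inverse of [g / z]. *)
Definition zdiv g : series k := sinv (fun n => g n.+1).

Definition bernoulli (m : nat) : k := m`!%:R * zdiv expm1 m.

Lemma size_sinv_seq f n : size (sinv_seq f n) = n.+1.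
Proof. by elim: n => //= n IHn; rewrite size_rcons IHn. Qed.

Lemma nth_sinv_seq f n i : (i <= n)%N -> (sinv_seq f n)`_i = sinv f i.
Proof.
elim: n => [|n IHn]; first by rewrite leqn0 => /eqP->.
rewrite leq_eqVlt => /orP[/eqP-> //|lt_in].
by rewrite /= nth_rcons size_sinv_seq lt_in IHn.
Qed.

Lemma sinvK f : f 0%N != 0 -> conv *%R (sinv f) f =1 monom 0 1.
Proof.
move=> f0 [|n]; rewrite /conv /monom /=.
  by rewrite big_ord_recl big_ord0 addr0 /sinv /= mulVf.
rewrite big_ord_recr /= subnn {2}/sinv /=.
rewrite nth_rcons size_sinv_seq ltnn eqxx.
rewrite mulrAC mulNr mulVf // mulN1r; apply/eqP; rewrite subr_eq0.
apply/eqP/eq_bigr => i _; rewrite nth_sinv_seq 1?mulrC //.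
by rewrite -ltnS.
Qed.

Lemma zdivK g : g 0%N = 0 -> g 1%N != 0 -> conv *%R (zdiv g) g =1 monom 1 1.
Proof.
move=> g0 g1 [|n]; first by rewrite /conv big_ord1 g0 mulr0.
rewrite /conv big_ord_recr /= subnn g0 mulr0 addr0.
have := sinvK (f := fun n => g n.+1) g1 n; rewrite /conv /monom eqSS => <-.
by apply: eq_bigr => i _; rewrite subSn // -ltnS.
Qed.

Lemma bernoulli_gf : [pchar k] =i pred0 ->
  conv *%R (fun m => bernoulli m / m`!%:R) expm1 =1 monom 1 1.
Proof.
move=> chk n; rewrite -(zdivK (g := expm1)).
- apply: eq_bigr => i _; congr (_ * _); rewrite /bernoulli mulrAC divff ?mul1r //.
  by rewrite ((pcharf0P k).1 chk) -lt0n fact_gt0.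
- by rewrite /expm1 /expz /monom /= divr1 subrr.
- by rewrite /expm1 /expz /monom /= subr0 divr1 expr1n oner_eq0.
Qed.

End Scalars.

Section Equations.
Variables (k : fieldType) (A : dendriformType k).

Definition starpow (x : series (aug A)) (m : nat) : series (aug A) :=
  iter m (conv (@astar k A) x) (monom 0 aug1).

(** [e = exp^*(x)]; the sum exists whenever [x 0 = 0]. *)
Definition is_starexp (x e : series (aug A)) : Prop :=
  is_sum (fun m n => m`!%:R^-1 *: starpow x m n) e.

Definition solves_prec (a : A) (X : series (aug A)) : Prop :=
  X =1 fun n => monom 0 aug1 n + conv (@aprec k A) (monom 1 (aug_in a)) X n.

Definition solves_succ (a : A) (Y : series (aug A)) : Prop :=
  Y =1 fun n => monom 0 aug1 n - conv (@asucc k A) Y (monom 1 (aug_in a)) n.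

Definition wprec (a : A) : series (aug A) :=
  fun n => iter n (aprec (aug_in a)) aug1.

Definition wsucc (a : A) : series (aug A) :=
  fun n => iter n (fun y => asucc y (aug_in a)) aug1.

Lemma dprec0 (b : A) : 0 ≺ b = 0.
Proof.
by have := dprec_linearl b (-1) 0 0; rewrite /= scaleN1r addNr scaleN1r addNr.
Qed.

Lemma dsucc0 (b : A) : b ≻ 0 = 0.
Proof.
by have := dsucc_linearr b (-1) 0 0; rewrite /= scaleN1r addNr scaleN1r addNr.
Qed.

Lemma dsuccZl c (b b' : A) : (c *: b) ≻ b' = c *: (b ≻ b').
Proof.
have h u v : (u + v) ≻ b' = u ≻ b' + v ≻ b'.
  by have := dsucc_linearl b' 1 u v; rewrite !scale1r.
have h0 : 0 ≻ b' = 0 by apply: (addrI (0 ≻ b')); rewrite -h !addr0.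
by have := dsucc_linearl b' c b 0; rewrite h0 !addr0.
Qed.

Lemma aprec0 (y : aug A) : aprec 0 y = 0.
Proof. by rewrite /aprec /= dprec0 scaler0 addr0. Qed.

Lemma asucc0 (x : aug A) : asucc x 0 = 0.
Proof. by rewrite /asucc /= dsucc0 scaler0 addr0. Qed.

Lemma conv_prec_monom1 (a : A) X n :
  conv (@aprec k A) (monom 1 (aug_in a)) X n =
  if n is n'.+1 then aprec (aug_in a) (X n') else 0.
Proof.
rewrite /conv /monom; case: n => [|n]; first by rewrite big_ord1 aprec0.
rewrite !big_ord_recl /= aprec0 add0r subSS subn0 big1 ?addr0 // => i _.
exact: aprec0.
Qed.

Lemma conv_succ_monom1 (a : A) Y n :
  conv (@asucc k A) Y (monom 1 (aug_in a)) n =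
  if n is n'.+1 then asucc (Y n') (aug_in a) else 0.
Proof.
rewrite /conv /monom; case: n => [|n]; first by rewrite big_ord1 asucc0.
rewrite !big_ord_recr /= subnn subSnn asucc0 addr0 big1 ?add0r // => i _.
rewrite subSn 1?ltnW // eqSS subn_eq0 leqNgt ltn_ord /=; exact: asucc0.
Qed.

Lemma solves_precP a X : solves_prec a X <-> X =1 wprec a.
Proof.
split=> h n; last first.
  by rewrite conv_prec_monom1; case: n => [|n]; rewrite !h /monom ?addr0 ?add0r.
elim: n => [|n IHn]; rewrite h conv_prec_monom1 /monom ?addr0 //=.
by rewrite add0r IHn.
Qed.

Lemma solves_succP a Y : solves_succ a Y <-> Y =1 fun n => (-1) ^+ n *: wsucc a n.
Proof.
have asuccN c y : - asucc (c *: y) (aug_in a) = (- c) *: asucc y (aug_in a).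
  rewrite scaleNr; congr (- _); rewrite /asucc /= dsuccZl.
  by apply/pair_eqP; rewrite /= scalerDr scalerA scaler0 !eqxx.
split=> h n; last first.
  rewrite conv_succ_monom1; case: n => [|n]; rewrite !h /monom /=.
    by rewrite scale1r subr0.
  by rewrite add0r asuccN exprS mulN1r.
elim: n => [|n IHn]; rewrite h conv_succ_monom1 /monom /=.
  by rewrite scale1r subr0.
by rewrite add0r IHn asuccN exprS mulN1r.
Qed.

Definition is_starlog (X Y Om : series (aug A)) : Prop :=
  [/\ Om 0%N = 0, is_starexp Om X & is_starexp (fun n => - Om n) Y].

Definition Lrhd (x : series A) : series A -> series A := conv (@rhd k A) x.
Definition Rlhd (x : series A) : series A -> series A :=
  fun y => conv (@lhd k A) y x.

End Equations.

(* Main.v *)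
Require Import Defs.
From HB Require Import structures.
From mathcomp Require Import all_boot all_order all_algebra.
From mathcomp Require Import boolp functions.

Set Implicit Arguments.
Unset Strict Implicit.
Unset Printing Implicit Defensive.

Import GRing.Theory.
Local Open Scope ring_scope.

(** Let [P y = Om ≻ y], [Q y = y ≺ Om] and [L = L_rhd[Om] = P - Q] on [A[[λ]]].
    The dendriform axioms make [P] and [Q] commute and give
    [Om^{*(n+1)} = Om * Om^{*n} = P Om^{*n} + Q^n Om = Q Om^{*n} + P^n Om], hence
    [exp^*(Om) - 1 = ((e^P - e^Q) / (P - Q)) Om = e^Q (((e^L - 1) / L) Om)] and
    likewise [1 - exp^*(-Om) = e^(-P) (((e^L - 1) / L) Om)].  Now let [Om] be
    the fixed point of [Om = (L / (e^L - 1)) (λa)], that is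
    [((e^L - 1) / L) Om = λa].  Since [e^Q (λa) = λa ≺ exp^*(Om)] and
    [e^(-P) (λa) = exp^*(-Om) ≻ λa], the series [exp^*(Om)] and [exp^*(-Om)]
    solve the equations of [X] and [Y], which have unique solutions.  The
    uniqueness of [Om] is the injectivity of [exp^*], and [R_lhd[Om] = -L]. *)

(** * Triangular sums and linear maps on finite sums *)

Lemma sum_triangle (V : nmodType) (F : nat -> nat -> V) n :
  \sum_(i < n) \sum_(j < n - i) F i j =
  \sum_(m < n) \sum_(i < m.+1) F i (m - i)%N.
Proof.
elim: n => [|n IHn]; first by rewrite !big_ord0.
rewrite [RHS]big_ord_recr -IHn /= big_ord_recr subSnn big_ord1 /=.
rewrite [in RHS]big_ord_recr /= subnn addrA -big_split /=; congr (_ + _).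
by apply: eq_bigr => i _; rewrite subSn 1?ltnW // big_ord_recr.
Qed.

Section LinearImage.
Variables (k : fieldType) (U V : lmodType k) (h : U -> V) (lh : linear h).

Lemma linear_image0 : h 0 = 0.
Proof. by have := lh (-1) 0 0; rewrite !scaleN1r !addNr. Qed.

Lemma linear_image_scale c u : h (c *: u) = c *: h u.
Proof. by have := lh c u 0; rewrite linear_image0 !addr0. Qed.

Lemma linear_image_sum I r (F : I -> U) :
  h (\sum_(i <- r) F i) = \sum_(i <- r) h (F i).
Proof.
apply: (big_morph h _ linear_image0) => x y.
by have := lh 1 x y; rewrite !scale1r.
Qed.

End LinearImage.

(** * The λ-adic filtration and power series in an operator *)

Section PowerSeries.
Variables (k : fieldType) (V : lmodType k).
Implicit Types (y : nat -> V) (u : nat -> nat -> V) (T S : (nat -> V) -> nat -> V).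

Definition vanishes n y := forall i, (i < n)%N -> y i = 0.

Definition raises d T := forall n y, vanishes n y -> vanishes (d + n) (T y).

(** A strong form of λ-adic convergence: only the terms of index at most [n] reach degree [n], so
    the finite sums in [tsum] give the full sum. *)
Definition summable u := forall m, vanishes m (u m).

Definition tsum u : nat -> V := fun n => \sum_(m < n.+1) u m n.

Lemma tsumE u M n : summable u -> (n < M)%N -> tsum u n = \sum_(m < M) u m n.
Proof.
move=> su lt_nM; rewrite /tsum -!(big_mkord xpredT (fun m => u m n)) /=.
rewrite [RHS](big_cat_nat (leq0n _) lt_nM) //= [X in _ = _ + X]big1_seq ?addr0 //.
by move=> i /andP[_]; rewrite mem_index_iota => /andP[/su].
Qed.

Lemma tsum_is_sum u : summable u -> is_sum u (tsum u).
Proof.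
move=> su d; exists d => M leM n ltn.
by rewrite (tsumE su (leq_trans ltn leM)).
Qed.

Lemma raises_iter d T m : raises d T -> raises (m * d) (iter m T).
Proof.
move=> rT; elim: m => [|m IHm] n y vy //=.
by rewrite mulSn -addnA; apply: rT; apply: IHm.
Qed.

Lemma raises_le d T n y : raises d T -> vanishes n y -> vanishes n (T y).
Proof. by move=> rT /rT vTy i lti; apply: vTy; apply: ltn_addl. Qed.

(** By linearity it is enough to apply [T] to [y - z], which lies in [λ^n V[[λ]]]. *)
Lemma raises_sub T n y z :
    linear T -> raises 0 T -> (forall i, (i < n)%N -> y i = z i) ->
  forall i, (i < n)%N -> T y i = T z i.
Proof.
move=> lT rT yz i lti.
have -> : T y = T (y - z) + T z.
  by rewrite -{1}(subrK z y) -[y - z]scale1r lT !scale1r.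
have vyz : vanishes n (y - z) by move=> j /yz; rewrite !fctE => ->; rewrite subrr.
by rewrite [LHS](congr1 (+%R^~ _) (rT _ _ vyz i lti)) add0r.
Qed.

(** In degree [n] the series may be replaced by a finite partial sum, by [raises_sub], and there
    linearity suffices. *)
Lemma linear_tsum T u :
  linear T -> raises 0 T -> summable u -> T (tsum u) = tsum (fun m => T (u m)).
Proof.
move=> lT rT su; apply: funext => n.
rewrite (@raises_sub T n.+1 _ (\sum_(m < n.+1) u m)) //.
  by rewrite (linear_image_sum lT) fct_sumE.
by move=> i lti; rewrite (tsumE su lti) fct_sumE.
Qed.

Lemma iter_is_linear (W : lmodType k) (T : {linear W -> W}) m : linear (iter m T).
Proof. by elim: m => // m IHm c y z; rewrite !iterS IHm linearP. Qed.

HB.instance Definition _ (W : lmodType k) (T : {linear W -> W}) m :=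
  GRing.isLinear.Build k W W *:%R (iter m T) (iter_is_linear T m).

(** In degree [n] only the pairs with [i + j <= n] contribute; this finite triangle is regrouped
    along its diagonals [i + j = m]. *)
Lemma tsum_tsum (w : nat -> nat -> nat -> V) :
    (forall i j, vanishes (i + j) (w i j)) ->
  tsum (fun i => tsum (w i)) =
  tsum (fun m => \sum_(i < m.+1) w i (m - i)%N).
Proof.
move=> vw; apply: funext => n; rewrite /tsum.
transitivity (\sum_(m < n.+1) \sum_(i < m.+1) w i (m - i)%N n); last first.
  by apply: eq_bigr => m _; rewrite fct_sumE.
rewrite -(sum_triangle (fun i j => w i j n)); apply: eq_bigr => i _.
rewrite -!(big_mkord xpredT (fun j => w i j n)).
rewrite [LHS](big_cat_nat (leq0n _) (leq_subr i n.+1)) /=.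
rewrite [X in _ + X]big1_seq ?addr0 //.
move=> j /andP[_]; rewrite mem_index_iota leq_subLR => /andP[h _].
exact: vw.
Qed.

Definition opsum (f : nat -> k) T y := tsum (fun m => f m *: iter m T y).

Lemma vanishes_scale n (c : k) y : vanishes n y -> vanishes n (c *: y).
Proof. by move=> vy i /vy; rewrite !fctE => ->; rewrite scaler0. Qed.

Lemma summable_op (f : nat -> k) T y :
  raises 1 T -> summable (fun m => f m *: iter m T y).
Proof.
move=> /raises_iter rT m; apply: vanishes_scale => i lti.
by apply: (rT m 0%N y) => //; rewrite muln1 addn0.
Qed.

(** A Cauchy product that keeps the powers of [T] to the left of those of [S], so commutation plays
    no part here. *)
Lemma opsum_comp (T S : {linear (nat -> V) -> nat -> V}) (f g : nat -> k) y :
    raises 1 T -> raises 1 S ->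
  opsum f T (opsum g S y) =
  tsum (fun m => \sum_(i < m.+1)
    (f i * g (m - i)%N) *: iter i T (iter (m - i) S y)).
Proof.
move=> rT rS; transitivity
  (tsum (fun i => tsum (fun j => (f i * g j) *: iter i T (iter j S y)))).
  congr tsum; apply: funext => i; rewrite /opsum linear_tsum; last 3 first.
  - exact: iter_is_linear.
  - by move=> n z; apply: raises_le (raises_iter rT).
  - exact: summable_op.
  apply: funext => n; rewrite !fctE scaler_sumr; apply: eq_bigr => j _.
  by rewrite linearZ !fctE scalerA.
rewrite tsum_tsum // => i j; apply: vanishes_scale => n lt_n.
have v0 : vanishes 0 y by [].
have := raises_iter (m := i) rT (raises_iter (m := j) rS v0).
by rewrite !muln1 addn0; apply.
Qed.

End PowerSeries.

(** * A recursion for the homogeneous parts of [e^Q (e^L - 1) / L] *)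

Section ExponentialQuotient.
Variables (k : fieldType) (chark0 : [pchar k] =i pred0) (V : lmodType k).

Lemma natS_neq0 n : n.+1%:R != 0 :> k.
Proof. by rewrite ((pcharf0P k).1 chark0). Qed.

Lemma natS_mul_invfact n : n.+1%:R / n.+1`!%:R = n`!%:R^-1 :> k.
Proof. by rewrite factS natrM invfM mulrA divff ?mul1r ?natS_neq0. Qed.

(** The part of degree [n] in [L] and [Q] of
    [e^Q (((e^L - 1) / L) v) = ((e^(L + Q) - e^Q) / L) v]. *)
Definition expquot (L Q : V -> V) (v : V) (n : nat) : V :=
  \sum_(i < n.+1)
    (i`!%:R^-1 * (n - i).+1`!%:R^-1) *: iter i Q (iter (n - i) L v).

Lemma iter_comm (L Q : V -> V) m v :
  (forall x, L (Q x) = Q (L x)) -> L (iter m Q v) = iter m Q (L v).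
Proof. by move=> LQ; elim: m => //= m IHm; rewrite LQ IHm. Qed.

(** With [F(t) = e^(tQ) ((e^(tL) - 1) / L) v], whose coefficient of [t^(n+1)] is [expquot L Q v n],
    this is the coefficient of [t^(n+1)] in [F' = (L + Q) F + e^(tQ) v]. *)
Lemma expquotS (L Q : {linear V -> V}) (v : V) (n : nat) :
    (forall x, L (Q x) = Q (L x)) ->
  n.+2%:R *: expquot L Q v n.+1 =
  L (expquot L Q v n) + Q (expquot L Q v n) + n.+1`!%:R^-1 *: iter n.+1 Q v.
Proof.
move=> LQ; pose t i j := (i`!%:R^-1 * j.+1`!%:R^-1 : k) *: iter i Q (iter j L v).
(* For [i + j = n + 1] the weight [n + 2] splits as [i + (j + 1)]: the factor [i] frees one [Q], and
   [j + 1] frees one [L] unless [j = 0], which leaves the inhomogeneous term. *)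
have -> : n.+2%:R *: expquot L Q v n.+1 =
    \sum_(i < n.+2) (i%:R *: t i (n.+1 - i)%N)
    + \sum_(i < n.+2) ((n.+1 - i).+1%:R *: t i (n.+1 - i)%N).
  rewrite scaler_sumr -big_split; apply: eq_bigr => i _ /=.
  by rewrite -scalerDl -natrD addnS subnKC // -ltnS.
rewrite big_ord_recl scale0r add0r addrC big_ord_recr /= subnn.
rewrite addrAC; congr (_ + _ + _).
- rewrite linear_sum; apply: eq_bigr => i _; rewrite [RHS]linearZ /=.
  rewrite subSn -1?ltnS //= /t scalerA.
  rewrite mulrCA natS_mul_invfact iter_comm //.
- rewrite linear_sum; apply: eq_bigr => i _; rewrite [RHS]linearZ /=.
  by rewrite /bump /= add1n subSS scalerA mulrA natS_mul_invfact.
- by rewrite scale1r /t /= invr1 mulr1.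
Qed.

(** The recursion determines [s], because [n + 2] is invertible in characteristic zero. *)
Lemma expquotE (L Q : {linear V -> V}) (v : V) (s : nat -> V) :
    (forall x, L (Q x) = Q (L x)) -> s 0%N = v ->
    (forall n, n.+2%:R *: s n.+1 =
      L (s n) + Q (s n) + n.+1`!%:R^-1 *: iter n.+1 Q v) ->
  s =1 expquot L Q v.
Proof.
move=> LQ s0 sS; elim=> [|n IHn].
  by rewrite s0 /expquot big_ord1 /= !invr1 mulr1 scale1r.
by apply: (scalerI (natS_neq0 n.+1)); rewrite sS expquotS // IHn.
Qed.

End ExponentialQuotient.

(** * Bilinear operations extended to power series *)

Section Convolution.
Variable k : fieldType.

Lemma conv_linearl (U V W : lmodType k) (op : U -> V -> W) (g : nat -> V) :
  (forall v, linear (op^~ v)) -> linear (fun f : nat -> U => conv op f g : nat -> W).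
Proof.
move=> opl c f f'; apply: funext => n; rewrite !fctE /conv scaler_sumr -big_split.
by apply: eq_bigr => i _; exact: opl.
Qed.

Lemma conv_linearr (U V W : lmodType k) (op : U -> V -> W) (f : nat -> U) :
  (forall u, linear (op u)) -> linear (fun g : nat -> V => conv op f g : nat -> W).
Proof.
move=> opr c g g'; apply: funext => n; rewrite !fctE /conv scaler_sumr -big_split.
by apply: eq_bigr => i _; exact: opr.
Qed.

Lemma sum_triangle_rev (V : nmodType) (F : nat -> nat -> V) n :
  \sum_(i < n.+1) \sum_(j < i.+1) F i j =
  \sum_(i < n.+1) \sum_(j < (n - i).+1) F (i + j)%N i.
Proof.
transitivity (\sum_(i < n.+1) \sum_(j < n.+1 - i) F (i + j)%N i).
  rewrite (sum_triangle (fun i j => F (i + j)%N i)); apply: eq_bigr => i _.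
  by apply: eq_bigr => j _; rewrite subnKC // -ltnS.
by apply: eq_bigr => i _; rewrite subSn // -ltnS.
Qed.

(** Four separate operations are allowed, so that one proof carries each dendriform axiom, and the
    associativity of [dstar], over to series. *)
Lemma convA (U1 U2 U3 V12 V23 W : lmodType k)
    (op12 : U1 -> U2 -> V12) (op23 : U2 -> U3 -> V23)
    (opl : V12 -> U3 -> W) (opr : U1 -> V23 -> W)
    (oplL : forall v, linear (opl^~ v)) (oprL : forall u, linear (opr u))
    (opA : forall x y z, opl (op12 x y) z = opr x (op23 y z)) f g h :
  conv opl (conv op12 f g) h = conv opr f (conv op23 g h).
Proof.
apply: funext => n; rewrite /conv.
transitivity (\sum_(i < n.+1) \sum_(j < i.+1)
    opr (f j) (op23 (g (i - j)%N) (h (n - i)%N))).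
  apply: eq_bigr => i _; rewrite (linear_image_sum (oplL _)).
  by apply: eq_bigr => j _; rewrite opA.
rewrite (sum_triangle_rev
  (fun i j => opr (f j) (op23 (g (i - j)%N) (h (n - i)%N)))).
apply: eq_bigr => i _; rewrite (linear_image_sum (oprL _)).
by apply: eq_bigr => j _; rewrite addKn subnDA.
Qed.

Lemma conv_vanishes (U V W : lmodType k) d (op : U -> V -> W) (f : nat -> U) n g :
    (forall v, linear (op^~ v)) -> (forall u, linear (op u)) ->
  vanishes d f -> vanishes n g -> vanishes (d + n) (conv op f g).
Proof.
move=> opl opr vf vg m ltm; rewrite /conv big1 // => i _.
case: (ltnP i d) => [/vf->|le_di]; first exact: (linear_image0 (opl _)).
rewrite vg ?(linear_image0 (opr _)) // ltn_subLR -1?ltnS //.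
by apply: leq_trans ltm _; rewrite leq_add2r.
Qed.

Lemma conv_monom1l (U V W : lmodType k) (op : U -> V -> W) u (g : nat -> V) n :
  (forall v, linear (op^~ v)) -> conv op (monom 1 u) g n.+1 = op u (g n).
Proof.
move=> opl; have op0 v : op 0 v = 0 := linear_image0 (opl v).
by rewrite /conv /monom !big_ord_recl /= op0 add0r subSS subn0 big1 ?addr0.
Qed.

Lemma conv_monom1r (U V W : lmodType k) (op : U -> V -> W) v (f : nat -> U) n :
  (forall u, linear (op u)) -> conv op f (monom 1 v) n.+1 = op (f n) v.
Proof.
move=> opr; have op0 u : op u 0 = 0 := linear_image0 (opr u).
rewrite /conv /monom !big_ord_recr /= subnn subSnn op0 addr0 big1 ?add0r // => i _.
rewrite subSn 1?ltnW // eqSS subn_eq0 leqNgt ltn_ord /=; exact: op0.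
Qed.

End Convolution.

(** * Multiplication operators and star powers on [A[[λ]]] *)

Section DendriformSeries.
Variables (k : fieldType) (A : dendriformType k).
Implicit Types (x y w : nat -> A) (a b c : A).

Definition dstar a b : A := a ≺ b + a ≻ b.

Lemma dstar_is_linearl b : linear (fun a => dstar a b).
Proof.
move=> c u v; rewrite /dstar dprec_linearl dsucc_linearl scalerDr.
by rewrite addrACA.
Qed.

Lemma dstar_is_linearr a : linear (fun b => dstar a b).
Proof.
move=> c u v; rewrite /dstar dprec_linearr dsucc_linearr scalerDr.
by rewrite addrACA.
Qed.

Lemma rhd_is_linearr a : linear (fun b => rhd a b).
Proof.
move=> c u v; rewrite /rhd dprec_linearl dsucc_linearr scalerBr.
by rewrite opprD addrACA.
Qed.

Lemma rhd_is_linearl b : linear (fun a => rhd a b).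
Proof.
move=> c u v; rewrite /rhd dprec_linearr dsucc_linearl scalerBr.
by rewrite opprD addrACA.
Qed.

(** The sum of the three dendriform axioms. *)
Lemma dstarA a b c : dstar (dstar a b) c = dstar a (dstar b c).
Proof.
rewrite /dstar -dsuccA -[a ≺ (_ + _)]dprecA.
have := dprec_linearl c 1 (a ≺ b) (a ≻ b); rewrite !scale1r => ->.
have := dsucc_linearr a 1 (b ≺ c) (b ≻ c); rewrite !scale1r => ->.
by rewrite dsucc_precA addrA.
Qed.

Lemma conv_dstar x y :
  conv dstar x y = conv (@dprec k A) x y + conv (@dsucc k A) x y.
Proof. by apply: funext => n; rewrite !fctE /conv -big_split. Qed.

Definition succ_by x : (nat -> A) -> nat -> A := fun y => conv (@dsucc k A) x y.
Definition prec_by x : (nat -> A) -> nat -> A := fun y => conv (@dprec k A) y x.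

HB.instance Definition _ x := GRing.isLinear.Build k _ _ *:%R (succ_by x)
  (conv_linearr x dsucc_linearr).
HB.instance Definition _ x := GRing.isLinear.Build k _ _ *:%R (prec_by x)
  (conv_linearl x dprec_linearl).
HB.instance Definition _ x := GRing.isLinear.Build k (nat -> A) (nat -> A)
  *:%R (Lrhd x : (nat -> A) -> nat -> A) (conv_linearr x rhd_is_linearr).

Lemma LrhdE x y : Lrhd x y = succ_by x y - prec_by x y.
Proof.
apply: funext => n; rewrite !fctE /Lrhd /succ_by /prec_by /conv.
(* [prec_by] has [x] as its right factor and [Lrhd] as its left one, so the index is reversed. *)
rewrite [X in _ - X](reindex_inj rev_ord_inj) /= -sumrB.
apply: eq_bigr => i _; rewrite /rhd subSS subKn //.
by rewrite -ltnS.
Qed.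

(** Since [b ◁ a = - (a ▷ b)], the two forms of the recursion differ only by signs. *)
Lemma RlhdE x y : Rlhd x y = - Lrhd x y.
Proof.
rewrite LrhdE opprB; apply: funext => n.
rewrite !fctE /Rlhd /succ_by /prec_by /conv.
rewrite [X in _ - X](reindex_inj rev_ord_inj) /= -sumrB.
apply: eq_bigr => i _; rewrite /lhd subSS subKn //.
by rewrite -ltnS.
Qed.

Lemma iter_Rlhd x y m : iter m (Rlhd x) y = (-1) ^+ m *: iter m (Lrhd x) y.
Proof.
elim: m => [|m IHm]; first by rewrite scale1r.
by rewrite !iterS IHm RlhdE linearZ /= exprS mulN1r scaleNr.
Qed.

(** The middle axiom [(x ≻ y) ≺ x = x ≻ (y ≺ x)]. *)
Lemma succ_prec_byC x y : succ_by x (prec_by x y) = prec_by x (succ_by x y).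
Proof.
rewrite /succ_by /prec_by; symmetry; apply: convA.
- exact: dprec_linearl.
- exact: dsucc_linearr.
- exact: dsucc_precA.
Qed.

(** The shifted powers [x, x * x, ...], which all lie in [A]. *)
Definition dpow x m : nat -> A := iter m (conv dstar x) x.

(** Iterating [(a ≺ b) ≺ c = a ≺ (b * c)] turns star powers on the right of [≺] into powers of [Q];
    this makes [y ≺ exp^*(x)] equal to [e^Q y]. *)
Lemma conv_prec_dpow x y m :
  conv (@dprec k A) y (dpow x m) = iter m.+1 (prec_by x) y.
Proof.
elim: m y => [//|m IHm] y; rewrite iterSr -IHm /dpow iterS.
symmetry; apply: convA; [exact: dprec_linearl|exact: dprec_linearr|].
exact: dprecA.
Qed.

(** The mirror image, from the third axiom, with powers of [P]. *)
Lemma conv_succ_dpow x y m :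
  conv (@dsucc k A) (dpow x m) y = iter m.+1 (succ_by x) y.
Proof.
elim: m y => [//|m IHm] y; rewrite iterS -IHm /dpow iterS.
apply: convA; [exact: dsucc_linearl|exact: dsucc_linearr|].
by move=> a b c; rewrite dsuccA.
Qed.

Lemma dpowSr x m : dpow x m.+1 = conv dstar (dpow x m) x.
Proof.
elim: m => // m IHm; rewrite {1}/dpow iterS -/(dpow x m.+1) {1}IHm.
symmetry; apply: convA; [exact: dstar_is_linearl|exact: dstar_is_linearr|].
exact: dstarA.
Qed.

Lemma dpowS_succ x m :
  dpow x m.+1 = succ_by x (dpow x m) + iter m.+1 (prec_by x) x.
Proof. by rewrite -conv_prec_dpow addrC /dpow iterS conv_dstar. Qed.

Lemma dpowS_prec x m :
  dpow x m.+1 = prec_by x (dpow x m) + iter m.+1 (succ_by x) x.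
Proof. by rewrite -conv_succ_dpow dpowSr conv_dstar. Qed.

Lemma dpowN x m : dpow (- x) m = (-1) ^+ m.+1 *: dpow x m.
Proof.
elim: m => [|m IHm]; first by rewrite expr1 scaleN1r.
rewrite /dpow !iterS -!/(dpow _ m) IHm.
have /= -> := linear_image_scale (conv_linearr (- x) dstar_is_linearr).
rewrite -[- x]scaleN1r.
have /= -> := linear_image_scale (conv_linearl (dpow x m) dstar_is_linearl).
by rewrite scalerA -exprSr.
Qed.

Lemma vanishes_dpow x m : x 0%N = 0 -> vanishes m.+1 (dpow x m).
Proof.
move=> x0; have vx : vanishes 1 x by case.
elim: m => // m IHm; rewrite /dpow iterS -add1n.
exact: conv_vanishes dstar_is_linearl dstar_is_linearr _ _.
Qed.

Lemma succ_by_raises x : x 0%N = 0 -> raises 1 (succ_by x).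
Proof.
move=> x0 n y vy; apply: conv_vanishes vy => //.
- exact: dsucc_linearl.
- exact: dsucc_linearr.
- by case.
Qed.

Lemma prec_by_raises x : x 0%N = 0 -> raises 1 (prec_by x).
Proof.
move=> x0 n y vy; rewrite addnC; apply: conv_vanishes vy _ => //.
- exact: dprec_linearl.
- exact: dprec_linearr.
- by case.
Qed.

Lemma Lrhd_raises x : x 0%N = 0 -> raises 1 (Lrhd x : (nat -> A) -> nat -> A).
Proof.
move=> x0 n y vy; apply: conv_vanishes vy => //.
- exact: rhd_is_linearl.
- exact: rhd_is_linearr.
- by case.
Qed.

End DendriformSeries.

(** * The star exponential expressed through [P], [Q] and [L] *)

Section Exponential.
Variables (k : fieldType) (chark0 : [pchar k] =i pred0) (A : dendriformType k).
Implicit Types (x y : nat -> A) (a : A).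

(** [exp^*(x) - 1] *)
Definition dexpm1 x : nat -> A := tsum (fun m => m.+1`!%:R^-1 *: dpow x m).

Definition augexp x : series (aug A) :=
  fun n => monom 0 aug1 n + aug_in (dexpm1 x n).

Lemma augexpE x n : augexp x n = (dexpm1 x n, (n == 0%N)%:R).
Proof. by case: n => [|n]; congr (_, _); rewrite /= ?add0r ?addr0. Qed.

Lemma summable_dexp (f : nat -> k) x :
  x 0%N = 0 -> summable (fun m => f m *: dpow x m).
Proof.
move=> x0 m; apply: vanishes_scale => i lti.
by apply: vanishes_dpow => //; apply: leq_trans lti _.
Qed.

Lemma dexpm1_0 x : x 0%N = 0 -> dexpm1 x 0%N = 0.
Proof.
by move=> x0; rewrite /dexpm1 /tsum big_ord1 !fctE (vanishes_dpow x0) // scaler0.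
Qed.

Lemma tsum_recl (u : nat -> nat -> A) :
  summable u -> tsum u = u 0%N + tsum (fun m => u m.+1).
Proof.
move=> su; apply: funext => n.
by rewrite !fctE (tsumE su (ltnW (ltnSn n.+1))) big_ord_recl.
Qed.

Lemma tsumN (u : nat -> nat -> A) : tsum (fun m => - u m) = - tsum u.
Proof. by apply: funext => n; rewrite /tsum !fctE sumrN. Qed.

Lemma Lrhd_prec_byC x y : Lrhd x (prec_by x y) = prec_by x (Lrhd x y).
Proof. by rewrite !LrhdE linearB /= succ_prec_byC. Qed.

Lemma Lrhd_succ_byC x y : Lrhd x (succ_by x y) = succ_by x (Lrhd x y).
Proof. by rewrite !LrhdE linearB /= succ_prec_byC. Qed.

(** By [dpowS_succ] and [P = L + Q], the left side satisfies the recursion of [expquotE]. *)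
Lemma dpow_expquot x m :
  m.+1`!%:R^-1 *: dpow x m = expquot (Lrhd x) (prec_by x) x m.
Proof.
move: m; apply: (expquotE chark0 (Lrhd_prec_byC x)) => [|n].
  by rewrite invr1 scale1r.
rewrite scalerA natS_mul_invfact // dpowS_succ scalerDr /= LrhdE subrK.
by rewrite linearZ.
Qed.

Lemma iter_opp (V : lmodType k) (T : {linear V -> V}) m v :
  iter m (\- T) v = (-1) ^+ m *: iter m T v.
Proof.
elim: m => [|m IHm]; first by rewrite scale1r.
by rewrite !iterS IHm /= linearZ /= exprS mulN1r scaleNr.
Qed.

(** The same recursion with [- P] in place of [Q]: now [L + (- P) = - Q], and [dpowS_prec] supplies
    the step. *)
Lemma dpowN_expquot x m :
  m.+1`!%:R^-1 *: dpow (- x) m = - expquot (Lrhd x) (\- (succ_by x)) x m.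
Proof.
apply: oppr_inj; rewrite opprK.
pose s n : nat -> A := ((-1) ^+ n / n.+1`!%:R) *: dpow x n.
have -> : - (m.+1`!%:R^-1 *: dpow (- x) m) = s m.
  by rewrite dpowN scalerA -scaleNr exprS mulN1r mulrN opprK mulrC.
move: m; apply: (expquotE chark0) => [y||n].
- by rewrite /= linearN /= Lrhd_succ_byC.
- by rewrite /s invr1 mulr1 scale1r.
rewrite iter_opp /s scalerA mulrCA natS_mul_invfact // dpowS_prec scalerDr.
rewrite /= LrhdE [X in _ = X + _]addrAC subrr add0r.
rewrite linearZ /= -scaleNr scalerA [_^-1 * _]mulrC; congr (_ *: _ + _).
by rewrite exprS mulN1r mulNr.
Qed.

(** With [L = Lrhd x], [P = succ_by x] and [Q = prec_by x = P - L], the two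
    lemmas below are [e^Q (((e^L - 1) / L) x) = exp^*(x) - 1] and
    [e^(- P) (((e^L - 1) / L) x) = 1 - exp^*(- x)]. *)
Lemma dexpm1E x : x 0%N = 0 ->
  dexpm1 x = opsum (fun m => m`!%:R^-1) (prec_by x)
    (opsum (fun m => m.+1`!%:R^-1) (Lrhd x) x).
Proof.
move=> x0; rewrite opsum_comp.
- by congr tsum; apply: funext => m; exact: dpow_expquot.
- exact: prec_by_raises.
- exact: Lrhd_raises.
Qed.

Lemma dexpm1NE x : x 0%N = 0 ->
  dexpm1 (- x) = - opsum (fun m => m`!%:R^-1) (\- (succ_by x))
    (opsum (fun m => m.+1`!%:R^-1) (Lrhd x) x).
Proof.
move=> x0; rewrite opsum_comp.
- rewrite -tsumN; congr tsum; apply: funext => m; exact: dpowN_expquot.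
- move=> n y vy i lti; rewrite /= !fctE (succ_by_raises x0 vy) ?oppr0 //.
- exact: Lrhd_raises.
Qed.

Section LogarithmEquation.
Variables (a : A) (x : nat -> A) (x0 : x 0%N = 0).
(** The recursive equation in inverted form, [((e^L - 1) / L) x = λa]. *)
Hypothesis xE :
  opsum (fun m => m.+1`!%:R^-1) (Lrhd x) x = monom 1 a :> (nat -> A).

(** The constant term of [e^Q] gives [λa], standing for [λa ≺ 1]; by [conv_prec_dpow] the other
    terms add up to [λa ≺ (exp^*(x) - 1)]. *)
Lemma dexpm1_prec :
  dexpm1 x = monom 1 a + conv (@dprec k A) (monom 1 a) (dexpm1 x).
Proof.
rewrite {1}dexpm1E // xE /opsum tsum_recl; last exact/summable_op/prec_by_raises.
rewrite invr1 scale1r /=; congr (_ + _).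
have rT : raises 0 (fun y => conv (@dprec k A) (monom 1 a) y).
  move=> n y vy; apply: conv_vanishes vy => //.
  - exact: dprec_linearl.
  - exact: dprec_linearr.
have /= -> := linear_tsum (conv_linearr (monom 1 a) (@dprec_linearr k A)) rT
  (summable_dexp (fun m => m.+1`!%:R^-1) x0).
congr tsum; apply: funext => m.
rewrite (linear_image_scale (conv_linearr _ (@dprec_linearr k A))).
by congr (_ *: _); rewrite -iterS -conv_prec_dpow.
Qed.

Lemma dexpm1N_succ :
  dexpm1 (- x) = - (monom 1 a + conv (@dsucc k A) (dexpm1 (- x)) (monom 1 a)).
Proof.
have nx0 : (- x) 0%N = 0 by rewrite fctE x0 oppr0.
rewrite {1}dexpm1NE // xE /opsum tsum_recl; last first.
  apply: summable_op => n y vy i lti.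
  by rewrite /= !fctE (succ_by_raises x0 vy) ?oppr0.
rewrite invr1 scale1r; congr (- (_ + _)).
have rT : raises 0 (fun y => conv (@dsucc k A) y (monom 1 a)).
  move=> n y vy; rewrite add0n -[n]addn0.
  apply: conv_vanishes vy _ => //.
  - exact: dsucc_linearl.
  - exact: dsucc_linearr.
have /= -> := linear_tsum (conv_linearl (monom 1 a) (@dsucc_linearl k A)) rT
  (summable_dexp (fun m => m.+1`!%:R^-1) nx0).
congr tsum; apply: funext => m.
rewrite (linear_image_scale (conv_linearl _ (@dsucc_linearl k A))).
rewrite -[LHS]/(_ *: iter m.+1 (\- succ_by x) (monom 1 a)) iter_opp.
(* The signs of [(- P)^(m+1)] and of the star power of [- x] are both [(-1)^(m+1)]. *)
rewrite -conv_succ_dpow dpowN; congr (_ *: _).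
by have /= -> := linear_image_scale
  (conv_linearl (monom 1 a) (@dsucc_linearl k A)).
Qed.

Lemma augexp_solves_prec : solves_prec a (augexp x).
Proof.
move=> n; rewrite conv_prec_monom1 {1}/augexp; congr (_ + _).
case: n => [|n]; first by rewrite dexpm1_0.
rewrite dexpm1_prec fctE conv_monom1l; last exact: dprec_linearl.
rewrite augexpE /aprec /=; congr (_, _); rewrite addrC; congr (_ + _).
(* The component of [augexp x n] along the unit is nonzero only for [n = 0], where [a ≺ 1 = a]
   matches the term [λa]. *)
by case: n => [|n]; rewrite ?scale1r ?scale0r.
Qed.

Lemma augexpN_solves_succ : solves_succ a (augexp (- x)).
Proof.
move=> n; rewrite conv_succ_monom1 {1}/augexp; congr (_ + _).
case: n => [|n]; first by rewrite dexpm1_0 ?fctE ?x0 ?oppr0.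
rewrite dexpm1N_succ !fctE conv_monom1r; last exact: dsucc_linearr.
rewrite augexpE /asucc; congr (_, _); last by rewrite oppr0.
rewrite addrC /=; congr (- (_ + _)).
by case: n => [|n]; rewrite ?scale1r ?scale0r.
Qed.

End LogarithmEquation.

Lemma astar_aug_in (u v : A) : astar (aug_in u) (aug_in v) = aug_in (dstar u v).
Proof.
rewrite /astar /aprec /asucc /= mulr0 !scale0r !addr0.
by congr (_, _); rewrite /= addr0.
Qed.

Lemma astar_aug1 (u : aug A) : astar u aug1 = u.
Proof.
case: u => u t; rewrite /astar /aprec /asucc /aug1 /= scale1r dsucc0.
have /= -> := linear_image0 (@dprec_linearr k A u).
rewrite add0r scaler0 mulr1.
congr (_, _); first by rewrite /= scaler0 !addr0.
by rewrite /= !add0r; exact: mulr1.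
Qed.

Lemma aug_in_sum I (r : seq I) (F : I -> A) :
  aug_in (\sum_(i <- r) F i) = \sum_(i <- r) aug_in (F i).
Proof.
apply: (big_morph (@aug_in k A)) => // u v.
by rewrite /aug_in; congr (_, _); rewrite /= addr0.
Qed.

Lemma aug_inZ (c : k) (u : A) : aug_in (c *: u) = c *: aug_in u.
Proof. by rewrite /aug_in; congr (_, _); rewrite /= scaler0. Qed.

Lemma starpow_aug_in x m n :
  starpow (fun i => aug_in (x i)) m.+1 n = aug_in (dpow x m n).
Proof.
elim: m n => [|m IHm] n; rewrite /starpow iterS.
  (* The unit enters only here, through [x * 1 = x]; later products stay in [A]. *)
  rewrite /conv /= big_ord_recr /= subnn /monom /= astar_aug1 big1 ?add0r //.
  move=> i _; rewrite subn_eq0 leqNgt ltn_ord /= astar_aug_in.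
  by have /= -> := linear_image0 (@dstar_is_linearr k A (x i)).
rewrite -/(starpow _ m.+1) /conv /dpow iterS /conv aug_in_sum.
by apply: eq_bigr => i _; rewrite IHm astar_aug_in.
Qed.

Lemma augexp_is_starexp x :
  x 0%N = 0 -> is_starexp (fun i => aug_in (x i)) (augexp x).
Proof.
(* The term of index 0 is the unit, so [M + 1] terms of the exponential contain [M] terms of
   [dexpm1]; hence the bound [d + 1]. *)
move=> x0 d; exists d.+1 => [[//|M]] leM n ltn.
rewrite big_ord_recl invr1 scale1r; congr (_ + _).
rewrite /dexpm1 (tsumE (summable_dexp _ x0) (leq_trans ltn leM)) aug_in_sum.
by apply: eq_bigr => i _; rewrite starpow_aug_in -aug_inZ.
Qed.

End Exponential.

(** * Fixed points of maps that look only at lower degrees *)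

Section Recursion.
Variable V : nmodType.
Implicit Types (Phi : (nat -> V) -> nat -> V) (x y : nat -> V).

Definition agree n x y := forall i, (i < n)%N -> x i = y i.

(** The coefficient of degree [n] in the iterates of [Phi] is stationary from iterate [n + 1] on;
    the fixed point collects these values. *)
Lemma causal_fixpoint Phi :
  (forall n x y, agree n x y -> Phi x n = Phi y n) -> exists x, x = Phi x.
Proof.
move=> causal.
have stable n : forall m m', (n < m)%N -> (n < m')%N ->
    iter m Phi (fun=> 0) n = iter m' Phi (fun=> 0) n.
  elim/ltn_ind: n => n IHn [//|m] [//|m'] ltm ltm'; rewrite !iterS.
  by apply: causal => i lti; apply: IHn => //; apply: leq_trans lti _.
exists (fun n => iter n.+1 Phi (fun=> 0) n); apply: funext => n.
by rewrite {1}iterS; apply: causal => i lti; apply: stable.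
Qed.

(** As [u] and [v] have no constant term, degree [j <= n] involves [x] and [y] only below degree
    [n]. *)
Lemma conv_agree (U W : nmodType) (op : V -> U -> W) n x y (u v : nat -> U) :
    (forall b, op b 0 = 0) -> u 0%N = 0 -> v 0%N = 0 ->
    agree n x y -> (forall i, (i <= n)%N -> u i = v i) ->
  forall j, (j <= n)%N -> conv op x u j = conv op y v j.
Proof.
move=> op0 u0 v0 xy uv j lej; apply: eq_bigr => i _.
have [->|lt_ij] : i = j :> nat \/ (i < j)%N.
  by have := ltn_ord i; rewrite ltnS leq_eqVlt => /orP[/eqP|]; auto.
  by rewrite subnn u0 v0 !op0.
by rewrite xy ?(leq_trans lt_ij) // uv // (leq_trans (leq_subr _ _)).
Qed.

End Recursion.

(** * Existence and uniqueness of the logarithm *)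

Section Logarithm.
Variables (k : fieldType) (chark0 : [pchar k] =i pred0) (A : dendriformType k).

Lemma iter_Lrhd_0 (x y : series A) m : y 0%N = 0 -> iter m (Lrhd x) y 0%N = 0.
Proof.
move=> y0; elim: m => //= m IHm; rewrite {1}/Lrhd /conv big_ord1 IHm.
exact: linear_image0 (@rhd_is_linearr k A _).
Qed.

Lemma iter_Lrhd_agree n (x y z : series A) m : z 0%N = 0 -> agree n x y ->
  forall j, (j <= n)%N -> iter m (Lrhd x) z j = iter m (Lrhd y) z j.
Proof.
move=> z0 xy; elim: m => //= m IHm; apply: conv_agree => //.
- by move=> b; exact: linear_image0 (@rhd_is_linearr k A b).
- exact: iter_Lrhd_0.
- exact: iter_Lrhd_0.
Qed.

(** Since [z] starts in degree one, degree [n] of the right side depends on [x] only below degree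
    [n]. *)
Lemma opsum_Lrhd_fixpoint (f : nat -> k) (z : nat -> A) :
  z 0%N = 0 -> exists x : nat -> A, x = opsum f (Lrhd x) z.
Proof.
move=> z0; apply: causal_fixpoint => n x y xy; apply: eq_bigr => m _.
by rewrite !fctE (iter_Lrhd_agree _ z0 xy).
Qed.

Lemma astar_0l (u : aug A) : astar 0 u = 0.
Proof.
rewrite /astar aprec0 add0r mul0r scale0r addr0 /asucc /= scale0r addr0.
by have /= -> := linear_image0 (@dsucc_linearl k A u.1).
Qed.

Lemma astar_0r (u : aug A) : astar u 0 = 0.
Proof.
rewrite /astar asucc0 addr0 mulr0 scale0r addr0 /aprec /= scale0r addr0.
by have /= -> := linear_image0 (@dprec_linearr k A u.1).
Qed.

Lemma starpow1 (x : series (aug A)) : starpow x 1 =1 x.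
Proof.
move=> n; rewrite /starpow /= /conv big_ord_recr /= subnn astar_aug1 big1 ?add0r //.
by move=> i _; rewrite /monom subn_eq0 leqNgt ltn_ord /= astar_0r.
Qed.

Lemma starpowS_0 (x : series (aug A)) m : x 0%N = 0 -> starpow x m.+1 0%N = 0.
Proof. by move=> x0; rewrite /starpow iterS /conv big_ord1 x0 astar_0l. Qed.

Lemma starpow_agree n (x y : series (aug A)) m :
    x 0%N = 0 -> y 0%N = 0 -> agree n x y ->
  forall j, (j < n)%N -> starpow x m j = starpow y m j.
Proof.
move=> x0 y0 xy; elim: m => // m IHm j ltj; rewrite /starpow !iterS.
apply: eq_bigr => i _; congr astar; first by apply: xy; apply: leq_trans ltj.
by apply: IHm; apply: leq_ltn_trans (leq_subr _ _) ltj.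
Qed.

(** In a product of at least two factors without constant term, a coefficient of degree [n] in one
    factor would meet a vanishing constant term. *)
Lemma starpowSS_agree n (x y : series (aug A)) m :
    x 0%N = 0 -> y 0%N = 0 -> agree n x y ->
  starpow x m.+2 n = starpow y m.+2 n.
Proof.
move=> x0 y0 xy; change (conv (@astar k A) x (starpow x m.+1) n =
  conv (@astar k A) y (starpow y m.+1) n).
move: (starpowS_0 m x0) (starpowS_0 m y0) (starpow_agree m.+1 x0 y0 xy).
move: (starpow x m.+1) (starpow y m.+1) => u v u0 v0 uv.
apply: eq_bigr => -[[|i] lti] _ /=; first by rewrite x0 y0 !astar_0l.
move: lti; rewrite ltnS leq_eqVlt => /orP[/eqP<-|lt_in].
  by rewrite subnn u0 v0 !astar_0r.
by rewrite xy // uv // ltn_subrL (leq_ltn_trans _ lt_in).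
Qed.

Lemma starexp_split (x : series (aug A)) M n :
  \sum_(m < M.+2) m`!%:R^-1 *: starpow x m n =
  monom 0 aug1 n + (x n + \sum_(m < M) m.+2`!%:R^-1 *: starpow x m.+2 n).
Proof.
by rewrite -(starpow1 x n) big_ord_recl big_ord_recl !invr1 !scale1r.
Qed.

(** By [starexp_split], degree [n] of the exponential is [x n] plus terms fixed by lower degrees, so
    induction applies. Components along the unit are allowed, as uniqueness is claimed in the
    augmented algebra. *)
Lemma starexp_inj (x y e : series (aug A)) :
    x 0%N = 0 -> y 0%N = 0 -> is_starexp x e -> is_starexp y e -> x =1 y.
Proof.
move=> x0 y0 ex ey n; elim/ltn_ind: n => n xy.
have [N sx] := ex n.+1; have [N' sy] := ey n.+1; pose M := (maxn N N').+2.
have leN : (N <= M)%N by do 2!apply: leqW; exact: leq_maxl.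
have leN' : (N' <= M)%N by do 2!apply: leqW; exact: leq_maxr.
have := sx M leN n (ltnSn n); rewrite -(sy M leN' n (ltnSn n)).
rewrite !starexp_split => /addrI.
under eq_bigr => m _ do rewrite (starpowSS_agree m x0 y0 xy).
exact: addIr.
Qed.

Lemma is_starexp_ext (x e e' : series (aug A)) :
  e =1 e' -> is_starexp x e -> is_starexp x e'.
Proof. by move=> ee' ex d; have [N h] := ex d; exists N => M /h{}h n /h->. Qed.

End Logarithm.

(** * Inverse scalar series and Bernoulli coefficients *)

Section Scalars.
Variables (k : fieldType) (chark0 : [pchar k] =i pred0).
Implicit Types f g : series k.

Lemma sinvS f n :
  sinv f n.+1 = - (f 0%N)^-1 * \sum_(i < n.+1) f (n.+1 - i)%N * sinv f i.
Proof.
rewrite {1}/sinv /= nth_rcons size_sinv_seq ltnn eqxx; congr (_ * _).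
by apply: eq_bigr => i _; rewrite nth_sinv_seq // -ltnS.
Qed.

(** Inversion commutes with the substitution of [- z] for [z]. *)
Lemma sinv_sign f n :
  sinv (fun m => (-1) ^+ m * f m) n = (-1) ^+ n * sinv f n.
Proof.
elim/ltn_ind: n => -[|n] IHn; first by rewrite /sinv /= !mul1r.
rewrite !sinvS mul1r mulrCA; congr (_ * _); rewrite mulr_sumr.
apply: eq_bigr => i _; rewrite IHn // mulrACA -exprD subnK //.
exact: ltnW.
Qed.

(** The series [(1 - e^(-z)) / z] is [(e^z - 1) / z] taken at [- z]. *)
Lemma zdiv_onemexpN n : zdiv (@onemexpN k) n = (-1) ^+ n * zdiv (@expm1 k) n.
Proof.
rewrite /zdiv -sinv_sign; congr (sinv _ n); apply: funext => m.
rewrite /onemexpN /expm1 /expz /monom /= sub0r subr0 expr1n exprS mulN1r.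
by rewrite mulNr opprK mul1r.
Qed.

Lemma bernoulli_div_fact n : bernoulli k n / n`!%:R = zdiv (@expm1 k) n.
Proof.
rewrite /bernoulli mulrAC divff ?mul1r //.
by rewrite ((pcharf0P k).1 chark0) -lt0n fact_gt0.
Qed.

Lemma convC f g n : conv *%R f g n = conv *%R g f n.
Proof.
rewrite /conv (reindex_inj rev_ord_inj) /=; apply: eq_bigr => i _.
by rewrite subSS subKn 1?mulrC // -ltnS.
Qed.

(** For a single operator, [opsum_comp] becomes the product of scalar series, and [g / z] times
    [z / g] is 1. *)
Lemma opsum_zdivK (V : lmodType k) (g : series k)
    (T : {linear (nat -> V) -> nat -> V}) y :
    g 1%N != 0 -> raises 1 T ->
  opsum (fun m => g m.+1) T (opsum (zdiv g) T y) = y.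
Proof.
move=> g1 rT; rewrite opsum_comp //.
transitivity (tsum (fun m => monom 0 (1 : k) m *: iter m T y)).
  congr tsum; apply: funext => m; rewrite -(sinvK (f := fun m => g m.+1) g1 m).
  rewrite convC scaler_suml; apply: eq_bigr => i _.
  by rewrite -iterD subnKC // -ltnS.
apply: funext => n; rewrite /tsum big_ord_recl big1 ?addr0 /monom /= ?scale1r //.
by move=> i _; rewrite scale0r.
Qed.

End Scalars.

Theorem theorem2 (k : fieldType) (chark0 : [pchar k] =i pred0)
    (A : dendriformType k) (a : A) (X Y : series (aug A))
    (hX : solves_prec a X) (hY : solves_succ a Y) :
  exists Om : series A,
    let OmA : series (aug A) := fun n => aug_in (Om n) in
    [/\ is_starlog X Y OmA,
        (forall Om' : series (aug A), is_starlog X Y Om' -> Om' =1 OmA),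
        is_opseries (zdiv (@onemexpN k)) (Rlhd Om) (monom 1 a) Om /\
        is_opseries (fun m => (-1) ^+ m * (bernoulli k m / m`!%:R))
          (Rlhd Om) (monom 1 a) Om
      & is_opseries (zdiv (@expm1 k)) (Lrhd Om) (monom 1 a) Om /\
        is_opseries (fun m => bernoulli k m / m`!%:R)
          (Lrhd Om) (monom 1 a) Om].
Proof.
have [Om OmE] := opsum_Lrhd_fixpoint (zdiv (@expm1 k)) (erefl (monom 1 a 0%N)).
have Om0 : Om 0%N = 0.
  by rewrite OmE /opsum /tsum big_ord1 fctE /= /monom scaler0.
have rL := Lrhd_raises Om0.
have la : opsum (fun m => m.+1`!%:R^-1) (Lrhd Om) Om = monom 1 a :> (nat -> A).
  (* Only the argument [Om] is unfolded; with the operator [Lrhd Om] kept fixed, the nonlinear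
     equation is inverted as a linear one. *)
  rewrite {2}OmE -[RHS](opsum_zdivK (g := @expm1 k) _ _ rL); last first.
    by rewrite /expm1 /expz /monom subr0 divr1 expr1n oner_eq0.
  congr opsum; apply: funext => m.
  by rewrite /expm1 /expz /monom subr0 expr1n mul1r.
have sumL : is_opseries (zdiv (@expm1 k)) (Lrhd Om) (monom 1 a) Om.
  by rewrite {2}OmE; apply: tsum_is_sum; apply: summable_op.
have sumR : is_opseries (zdiv (@onemexpN k)) (Rlhd Om) (monom 1 a) Om.
  move=> d; have [N h] := sumL d; exists N => M leM n ltn.
  rewrite -(h M leM n ltn); apply: eq_bigr => m _.
  (* The sign of the coefficient cancels the one from [Rlhd Om = - Lrhd Om], so both series agree
     term by term. *)
  rewrite iter_Rlhd zdiv_onemexpN fctE scalerA mulrAC -exprD addnn.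
  by rewrite -signr_odd odd_double mul1r.
have bern : (fun m => bernoulli k m / m`!%:R) = zdiv (@expm1 k).
  by apply: funext => m; exact: bernoulli_div_fact.
have bernN : (fun m => (-1) ^+ m * (bernoulli k m / m`!%:R)) = zdiv (@onemexpN k).
  by apply: funext => m; rewrite bernoulli_div_fact // zdiv_onemexpN.
have eX : is_starexp (fun n => aug_in (Om n)) X.
  apply: is_starexp_ext (augexp_is_starexp Om0) => n.
  (* Both [augexp Om] and [X] solve the equation of [X], hence both equal [wprec a]. *)
  have /solves_precP -> := augexp_solves_prec chark0 Om0 la.
  by have /solves_precP -> := hX.
have eY : is_starexp (fun n => - aug_in (Om n)) Y.
  have -> : (fun n => - aug_in (Om n)) = fun n => aug_in ((- Om) n).
    by apply: funext => n; rewrite /aug_in; congr (_, _); rewrite /= oppr0.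
  have nOm0 : (- Om) 0%N = 0 by rewrite fctE Om0 oppr0.
  apply: is_starexp_ext (augexp_is_starexp nOm0) => n.
  have /solves_succP -> := augexpN_solves_succ chark0 Om0 la.
  by have /solves_succP -> := hY.
exists Om; split; rewrite ?bern ?bernN //.
- by split; rewrite ?Om0.
- by move=> Om' [Om'0 eX' _]; apply: starexp_inj eX' eX => //; rewrite Om0.
Qed.
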